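(* Let $G$ be a connected finite simple graph and let $H,K$ be subgraphs of $G$ with $H\cup K=G$ and $H\cap K=K_r=(U,F)$ a complete graph (a separating clique), where neither $H$ nor $K$ coincides with $K_r$. Then, writing $Q(\cdot)$ for $Q(\cdot;x,y)$, \[ Q(G)=Q(H-U)\,Q(K-U)+\frac{1}{y}\sum_{\emptyset\neq A\subseteq U}\frac{1}{x^{|A|}}\sum_{\substack{B\subseteq U\\ B\supseteq U\setminus A}}\ \sum_{\substack{C\subseteq U\\ C\supseteq U\setminus A}}(-1)^{|B|+|C|}\,Q(H-B)\,Q(K-C). \]
   Context: For a finite simple graph $G=(V,E)$, $Q(G;x,y)=\sum_{X\subseteq V}x^{|X|}y^{k(G[X])}$, where $G[X]$ is the induced subgraph and $k$ the number of connected components (the null graph has $k=0$). For a vertex set $B$, $H-B$ denotes the graph obtained from $H$ by removing the vertices of $B$ and their incident edges. *)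

(* Defs.v *)
From HB Require Import structures.
From mathcomp Require Import all_boot all_order all_algebra.
From mathcomp Require Import mpoly.

Set Implicit Arguments.
Unset Strict Implicit.
Unset Printing Implicit Defensive.

Import GRing.Theory.
Local Open Scope ring_scope.

(* A graph carries its own vertex set inside an ambient finite type, so that
   G, H, K, their unions, intersections and vertex deletions all live in one
   type.  An edge is a two-element subset of the vertex set; the axiom is
   boolean, so Leibniz equality of graphs is equality of vertex and edge sets. *)
Record sgraph (T : finType) := SGraph {
  verts : {set T};
  edges : {set {set T}};
  edges_axiom : edges \subset [set e in powerset verts | #|e| == 2%N]
}.

Section Graphs.
Variable T : finType.
Implicit Types (G H K : sgraph T) (X B : {set T}) (e : {set T}).

Definition adj G : rel T := [rel u v | [set u; v] \in edges G].

Definition subgraph H G : Prop :=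
  verts H \subset verts G /\ edges H \subset edges G.

Fact gunion_axiom H K :
  edges H :|: edges K
    \subset [set e in powerset (verts H :|: verts K) | #|e| == 2%N].
Proof.
apply/subsetP => e; rewrite inE => /orP[] eE.
- have := subsetP (edges_axiom H) _ eE; rewrite !inE => /andP[sV ->].
  by rewrite (subset_trans sV) ?subsetUl.
- have := subsetP (edges_axiom K) _ eE; rewrite !inE => /andP[sV ->].
  by rewrite (subset_trans sV) ?subsetUr.
Qed.

Definition gunion H K : sgraph T := SGraph (gunion_axiom H K).

Fact ginter_axiom H K :
  edges H :&: edges K
    \subset [set e in powerset (verts H :&: verts K) | #|e| == 2%N].
Proof.
apply/subsetP => e; rewrite inE => /andP[eH eK].
have := subsetP (edges_axiom H) _ eH; rewrite !inE => /andP[sH ->].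
have := subsetP (edges_axiom K) _ eK; rewrite !inE => /andP[sK _].
by rewrite subsetI sH sK.
Qed.

Definition ginter H K : sgraph T := SGraph (ginter_axiom H K).

Fact induced_axiom G X :
  [set e in edges G | e \subset X]
    \subset [set e in powerset (verts G :&: X) | #|e| == 2%N].
Proof.
apply/subsetP => e; rewrite !inE => /andP[eG sX].
have := subsetP (edges_axiom G) _ eG; rewrite !inE => /andP[sG ->].
by rewrite subsetI sG sX.
Qed.

Definition induced G X : sgraph T := SGraph (induced_axiom G X).

Fact gdel_axiom G B :
  [set e in edges G | [disjoint e & B]]
    \subset [set e in powerset (verts G :\: B) | #|e| == 2%N].
Proof.
apply/subsetP => e; rewrite !inE => /andP[eG dB].
have := subsetP (edges_axiom G) _ eG; rewrite !inE => /andP[sG ->].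
by rewrite subsetD sG dB.
Qed.

Definition gdel G B : sgraph T := SGraph (gdel_axiom G B).

Definition complete G : Prop :=
  {in verts G &, forall u v, u != v -> adj G u v}.

Definition gconnected G : Prop :=
  verts G != set0 /\ {in verts G &, forall u v, connect (adj G) u v}.

(* Points of T outside [verts G] are isolated for [adj G]; [n_comp] restricted
   to [verts G] does not count them, so the null graph has 0 components. *)
Definition ncomponents G : nat := n_comp (adj G) (verts G).

End Graphs.

Notation polyxy := {mpoly int[2]}.
Notation Xvar := ('X_(0 : 'I_2) : polyxy).
Notation Yvar := ('X_(1 : 'I_2) : polyxy).

Definition Qpoly (T : finType) (G : sgraph T) : polyxy :=
  \sum_(X : {set T} | X \subset verts G)
    Xvar ^+ #|X| * Yvar ^+ ncomponents (induced G X).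

(* Since 1/x and 1/y occur, identities between the polynomials Q are read in
   the field of rational functions in x and y. *)
Notation ratxy := {fraction polyxy}.
Definition xf : ratxy := tofrac Xvar.
Definition yf : ratxy := tofrac Yvar.
Definition Q (T : finType) (G : sgraph T) : ratxy := tofrac (Qpoly G).

(* Main.v *)
(* Split [Q(G)] according to the trace [A = X :&: U] of the vertex set [X], and
   put [X1 = X :&: V(H)], [X2 = X :&: V(K)].  A component of [G[X]] avoiding [A]
   is a component avoiding [A] of exactly one of [H[X1]], [K[X2]]; as [A] is a
   clique, exactly one component of each of the three graphs meets [A] when [A]
   is nonempty, and none does otherwise.  So
   [k(G[X]) + (A != set0) = k(H[X1]) + k(K[X2])], and the part of [Q(G)] with
   trace [A] is [x^-|A| y^-(A != set0)] times the product of the corresponding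
   parts of [Q(H)] and [Q(K)].  By inclusion-exclusion, the part of [Q(H)] with
   trace [A] is, up to the sign [(-1)^|U \ A|], the alternating sum of the
   [Q(H - B)] over [U \ A <= B <= U]; the signs from [H] and [K] cancel. *)
Require Import Defs.
From HB Require Import structures.
From mathcomp Require Import all_boot all_order all_algebra.
From mathcomp Require Import mpoly.

Set Implicit Arguments.
Unset Strict Implicit.
Unset Printing Implicit Defensive.

Import GRing.Theory.
Local Open Scope ring_scope.

(** * Connectivity classes of a symmetric relation *)

Section ConnectClasses.
Variable T : finType.
Implicit Types (e : rel T) (x y : T) (a A X : {set T}).

Definition cclass e x : {set T} := [set y | connect e x y].

Definition cclasses e a : {set {set T}} := cclass e @: a.

Definition cclasses_off e A a : {set {set T}} :=
  [set c in cclasses e a | [disjoint c & A]].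

Lemma symmetric_closed e X :
  ssrbool.symmetric e -> (forall x y, e x y -> x \in X) -> closed e X.
Proof. by move=> se eX x y xy; rewrite (eX _ _ xy) (eX y x) // se. Qed.

Lemma cclass_id e x : x \in cclass e x.
Proof. by rewrite inE. Qed.

Lemma eq_cclass e x y : connect_sym e -> connect e x y -> cclass e x = cclass e y.
Proof. by move=> se xy; apply/setP=> z; rewrite !inE (same_connect se xy). Qed.

Lemma cclass_subset e a x : closed e a -> x \in a -> cclass e x \subset a.
Proof.
move=> ca xa; apply/subsetP=> y; rewrite inE => xy.
by rewrite -(closed_connect ca xy).
Qed.

(** Roots depend on the relation, classes are plain sets: counting classes makes components of
    different relations comparable. *)
Lemma n_comp_cclasses e a :
  connect_sym e -> closed e a -> n_comp e a = #|cclasses e a|.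
Proof.
move=> se ca; rewrite /n_comp_mem.
have -> : cclasses e a = cclass e @: [predI roots e & a].
  apply/setP=> c; apply/imsetP/imsetP => [[x xa ->]|[x /andP[_ xa] ->]]; last first.
    by exists x.
  exists (fingraph.root e x); last exact/eq_cclass/connect_root.
  by apply/andP; split; [apply: roots_root|rewrite -(closed_connect ca (connect_root e x))].
rewrite card_in_imset; first by apply: eq_card => x; rewrite !inE.
move=> x y /andP[/eqP rx _] /andP[/eqP ry _] exy.
have : y \in cclass e x by rewrite exy cclass_id.
by rewrite inE -(root_connect se) rx ry => /eqP.
Qed.

(** Any two points of the clique [A] are connected, so all classes meeting [A] coincide; there is
    one if [A] is nonempty and none otherwise. *)
Lemma card_cclasses_clique e A a :
  connect_sym e -> A \subset a -> {in A &, forall u v, u != v -> e u v} ->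
  #|cclasses e a| = (#|cclasses_off e A a| + (A != set0))%N.
Proof.
move=> se sAa clA.
rewrite -(cardsID [set c : {set T} | [disjoint c & A]]).
congr addn; first by apply: eq_card => c; rewrite !inE.
have [->|/set0Pn[u uA]] := eqVneq A set0.
  apply/eqP; rewrite cards_eq0; apply/eqP/setP=> c.
  by rewrite !inE -setI_eq0 setI0 eqxx.
rewrite (_ : _ :\: _ = [set cclass e u]) ?cards1 //.
apply/setP=> c; rewrite !inE; apply/andP/eqP => [[meet /imsetP[x xa cx]]|->].
  move: meet; rewrite -setI_eq0 => /set0Pn[v /setIP[]].
  rewrite cx inE => xv vA; rewrite (eq_cclass se xv); apply: eq_cclass => //.
  by have [->//|vu] := eqVneq v u; apply/connect1/clA.
split; last by apply/imsetP; exists u => //; apply: (subsetP sAa).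
by rewrite -setI_eq0; apply/set0Pn; exists u; rewrite inE cclass_id.
Qed.

End ConnectClasses.

(** * Gluing two relations along a common clique *)

Section Gluing.
Variables (T : finType) (e e1 e2 : rel T) (X1 X2 : {set T}).
Hypotheses (e1_sym : ssrbool.symmetric e1) (e2_sym : ssrbool.symmetric e2).
Hypotheses (e1_in : forall x y, e1 x y -> x \in X1)
           (e2_in : forall x y, e2 x y -> x \in X2).
Hypothesis eE : e =2 relU e1 e2.
Let A := X1 :&: X2.

Lemma cclass_sub_glue x : cclass e1 x \subset cclass e x.
Proof.
apply/subsetP=> y; rewrite !inE; apply: connect_sub => u v uv.
by apply: connect1; rewrite eE /= uv.
Qed.

(* An edge of [e2] can only leave this class through a vertex of [X1 :&: X2]. *)
Lemma cclass_glue_left x : x \in X1 ->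
  [disjoint cclass e1 x & A] -> cclass e x = cclass e1 x.
Proof.
move=> xX dis; apply/eqP; rewrite eqEsubset cclass_sub_glue andbT.
have c1 := symmetric_closed e1_sym e1_in.
have se1 := sym_connect_sym e1_sym.
suff cl : closed e (cclass e1 x) by apply: cclass_subset => //; apply: cclass_id.
have se : ssrbool.symmetric e by move=> u v; rewrite !eE /= e1_sym e2_sym.
apply: intro_closed; first exact: sym_connect_sym.
move=> u v; rewrite eE => /orP[uv|uv] uc.
  by move: uc; rewrite !inE => xu; apply: connect_trans xu (connect1 uv).
have uA : u \in A.
  by rewrite inE (subsetP (cclass_subset c1 xX) u uc) (e2_in uv).
by rewrite (disjointFr dis uc) in uA.
Qed.

(** Avoiding [A] passes from an [e]-class to the [e1]-class inside it, and an [e1]-class avoiding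
    [A] is already a full [e]-class. *)
Lemma cclasses_off_glue_left : cclasses_off e A X1 = cclasses_off e1 A X1.
Proof.
apply/setP=> c; rewrite !inE; apply/andP/andP => -[/imsetP[x xX ->] dis].
  have dis1 := disjointWl (cclass_sub_glue x) dis.
  by rewrite (cclass_glue_left xX dis1) dis1 imset_f.
by rewrite -{1 2}(cclass_glue_left xX dis) imset_f // cclass_glue_left.
Qed.

End Gluing.

Lemma card_cclasses_glue (T : finType) (e e1 e2 : rel T) (X1 X2 : {set T}) :
    ssrbool.symmetric e1 -> ssrbool.symmetric e2 ->
    (forall x y, e1 x y -> x \in X1) -> (forall x y, e2 x y -> x \in X2) ->
    e =2 relU e1 e2 ->
    {in X1 :&: X2 &, forall u v, u != v -> e1 u v && e2 u v} ->
  (#|cclasses e (X1 :|: X2)| + (X1 :&: X2 != set0) =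
   #|cclasses e1 X1| + #|cclasses e2 X2|)%N.
Proof.
move=> s1 s2 in1 in2 eE cl; set A := X1 :&: X2.
have s : ssrbool.symmetric e by move=> u v; rewrite !eE /= s1 s2.
have sE21 : e =2 relU e2 e1 by move=> u v; rewrite eE /= orbC.
have [cl1 cl2 clU] : [/\ {in A &, forall u v, u != v -> e1 u v},
    {in A &, forall u v, u != v -> e2 u v} &
    {in A &, forall u v, u != v -> e u v}].
  by split=> u v uA vA uv; rewrite ?eE /=; have /andP[? ?] := cl u v uA vA uv;
    rewrite ?orbT //; apply/orP; left.
have sAU : A \subset X1 :|: X2 by rewrite subIset // subsetUl.
rewrite (card_cclasses_clique (sym_connect_sym s) sAU clU).
rewrite (card_cclasses_clique (sym_connect_sym s1) (subsetIl X1 X2) cl1).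
rewrite (card_cclasses_clique (sym_connect_sym s2) (subsetIr X1 X2) cl2).
(* The indicator of [A != set0] now occurs twice on each side and cancels, leaving only classes that
   avoid [A]. *)
rewrite -/A addnACA -addnA; congr addn.
rewrite -(cclasses_off_glue_left s1 s2 in1 in2 eE).
have := cclasses_off_glue_left s2 s1 in2 in1 sE21; rewrite setIC -/A => <-.
rewrite -cardsUI; set I := _ :&: _.
(* A class counted from both sides would be an [e1]-class, hence inside [X1], yet contain a point
   [y] of [X2]; then [y] lies in [A], which the class avoids. *)
suff -> : I = set0.
  rewrite cards0 addn0; apply: eq_card => c.
  by rewrite !inE /cclasses imsetU inE andb_orl.
apply/setP=> c; rewrite !inE; apply/negP.
case/andP=> /andP[/imsetP[x x1 ->] dis] /andP[/imsetP[y y2 exy] _].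
have dis1 := disjointWl (cclass_sub_glue eE x) dis.
have yx : y \in cclass e x by rewrite exy cclass_id.
have yA : y \in A.
  rewrite inE y2 andbT.
  apply: (subsetP (cclass_subset (symmetric_closed s1 in1) x1)).
  by rewrite -(cclass_glue_left s1 s2 in1 in2 eE x1 dis1).
by rewrite (disjointFr dis yx) in yA.
Qed.

(** * Components of induced subgraphs *)

Section InducedSubgraphs.
Variable T : finType.
Implicit Types (G H K : sgraph T) (X B U A : {set T}).

Lemma sgraph_eq G H : verts G = verts H -> edges G = edges H -> G = H.
Proof.
case: G H => [V E p] [V' E' p'] /= eV eE; subst V' E'.
by rewrite (bool_irrelevance p p').
Qed.

Lemma induced_gdel G B X :
  [disjoint X & B] -> induced (gdel G B) X = induced G X.
Proof.
move=> dXB; apply: sgraph_eq; apply/setP=> z; rewrite !inE.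
  have [zX|] := boolP (z \in X); last by rewrite !andbF.
  by rewrite (disjointFr dXB zX).
rewrite -andbA; congr andb.
by have [zX|] := boolP (z \subset X); rewrite ?andbF // (disjointWl zX dXB).
Qed.

Lemma adj_sym G : ssrbool.symmetric (adj G).
Proof. by move=> u v; rewrite /adj /= setUC. Qed.

Lemma adj_verts G u v : adj G u v -> u \in verts G.
Proof.
move=> uv; have := subsetP (edges_axiom G) _ uv; rewrite !inE => /andP[sV _].
by apply: (subsetP sV); rewrite !inE eqxx.
Qed.

Lemma ncomponentsE G : ncomponents G = #|cclasses (adj G) (verts G)|.
Proof.
apply: n_comp_cclasses; first exact/sym_connect_sym/adj_sym.
exact: symmetric_closed (@adj_sym G) (@adj_verts G).
Qed.

Lemma adj_induced G X u v :
  adj (induced G X) u v = [&& adj G u v, u \in X & v \in X].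
Proof. by rewrite /adj /= inE subUset !sub1set. Qed.

(** The last hypothesis says that [X1] and [X2] agree on the shared vertices. Hence an edge of [H]
    with ends in [X1 :|: X2] has both ends in [X1], and likewise for [K], so the adjacency of the
    union is the union of the two adjacencies. *)
Lemma ncomponents_glue H K X1 X2 :
    complete (ginter H K) ->
    X1 \subset verts H -> X2 \subset verts K ->
    X1 :&: verts K = X2 :&: verts H ->
  (ncomponents (induced (gunion H K) (X1 :|: X2)) + (X1 :&: X2 != set0) =
   ncomponents (induced H X1) + ncomponents (induced K X2))%N.
Proof.
move=> clq s1 s2 tr.
have memK u : u \in X1 -> u \in verts K -> u \in X2.
  by move=> u1 uK; have /setP/(_ u) := tr; rewrite !inE u1 uK /= => /esym/andP[].
have memH u : u \in X2 -> u \in verts H -> u \in X1.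
  by move=> u2 uH; have /setP/(_ u) := tr; rewrite !inE u2 uH /= => /andP[].
have E1 : verts (induced H X1) = X1 by apply/setIidPr.
have E2 : verts (induced K X2) = X2 by apply/setIidPr.
have E : verts (induced (gunion H K) (X1 :|: X2)) = X1 :|: X2.
  by apply/setIidPr; rewrite setUSS.
rewrite !ncomponentsE E E1 E2; apply: card_cclasses_glue.
- exact: adj_sym.
- exact: adj_sym.
- by move=> x y /adj_verts; rewrite E1.
- by move=> x y /adj_verts; rewrite E2.
- move=> u v; rewrite /= !adj_induced !inE.
  have -> : adj (gunion H K) u v = adj H u v || adj K u v by rewrite /adj /= inE.
  apply/idP/idP; last first.
    by case/orP=> /and3P[-> -> ->]; rewrite ?orbT.
  case/andP=> /orP[] uv /andP[uX vX].
    have uH := adj_verts uv; have vH : v \in verts H.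
      by rewrite adj_sym in uv; apply: adj_verts uv.
    apply/orP; left; rewrite uv /=.
    by apply/andP; split; [case/orP: uX|case/orP: vX] => // /memH; apply.
  have uK := adj_verts uv; have vK : v \in verts K.
    by rewrite adj_sym in uv; apply: adj_verts uv.
  apply/orP; right; rewrite uv /=.
  by apply/andP; split; [case/orP: uX|case/orP: vX] => // /memK; apply.
- move=> u v /setIP[u1 u2] /setIP[v1 v2] uv.
  rewrite !adj_induced u1 u2 v1 v2 !andbT.
  have : adj (ginter H K) u v.
    by apply: clq; rewrite // inE ?(subsetP s1) ?(subsetP s2).
  by rewrite /adj /= inE.
Qed.

End InducedSubgraphs.

(** * Sums over vertex sets with prescribed trace *)

Section Weights.
Variable T : finType.
Implicit Types (G H K : sgraph T) (X B U A P R : {set T}).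

Definition wt G X : ratxy := xf ^+ #|X| * yf ^+ ncomponents (induced G X).

Definition Qtrace G U A : ratxy :=
  \sum_(X : {set T} | (X \subset verts G) && (X :&: U == A)) wt G X.

Lemma mpolyXU_neq0 (n : nat) (R : nzRingType) (i : 'I_n) :
  'X_i != 0 :> {mpoly R[n]}.
Proof.
apply/eqP=> /(congr1 (mcoeff U_(i)%MM)) /eqP.
by rewrite mcoeffXU eqxx mcoeff0 oner_eq0.
Qed.

Lemma xf_neq0 : xf != 0.
Proof. by rewrite tofrac_eq0 mpolyXU_neq0. Qed.

Lemma yf_neq0 : yf != 0.
Proof. by rewrite tofrac_eq0 mpolyXU_neq0. Qed.

Lemma QE G : Q G = \sum_(X : {set T} | X \subset verts G) wt G X.
Proof.
rewrite /Q /Qpoly rmorph_sum /=; apply: eq_bigr => X _.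
by rewrite rmorphM !rmorphXn.
Qed.

Lemma Q_gdelE G B :
  Q (gdel G B) = \sum_(X : {set T} | (X \subset verts G) && [disjoint X & B]) wt G X.
Proof.
rewrite QE; apply: eq_big => [X|X]; rewrite /= subsetD // => /andP[_ dXB].
by rewrite /wt induced_gdel.
Qed.

Lemma Q_gdel_trace G U : Q (gdel G U) = Qtrace G U set0.
Proof. by rewrite Q_gdelE; apply: eq_bigl => X; rewrite setI_eq0. Qed.

(** If [P] is proper in [R], toggling a fixed point [a] of [R] outside [P] pairs the sets of the
    interval with opposite signs. *)
Lemma sum_sign_interval (F : pzRingType) P R : P \subset R ->
  \sum_(B : {set T} | (B \subset R) && (P \subset B)) (-1) ^+ #|B|
    = (if P == R then (-1) ^+ #|P| else 0) :> F.
Proof.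
move=> sPR; have [<-|neq] := eqVneq P R.
  rewrite (big_pred1 P) // => B; rewrite /= eqEsubset //.
have /properP[_ [a aR aP]] : P \proper R by rewrite properEneq neq.
rewrite (bigID (fun B : {set T} => a \in B)) /=.
rewrite (reindex_onto (fun B => a |: B) (fun B => B :\ a)) /=; last first.
  by move=> B /andP[_ aB]; rewrite setD1K.
rewrite (eq_bigl (fun B : {set T} => ((B \subset R) && (P \subset B)) && (a \notin B))).
  rewrite -big_split big1 //= => B /andP[_ aB].
  by rewrite cardsU1 aB exprS mulN1r addNr.
move=> B; rewrite setU11 andbT subUset sub1set aR /=.
have [aB|aB] := boolP (a \in B).
  rewrite andbF; apply/negbTE; rewrite negb_and; apply/orP; right.
  by apply: contraTneq aB => <-; rewrite !inE eqxx.
rewrite setU1K // eqxx !andbT; congr andb.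
by rewrite -subDset (setDidPl _) // disjoint_sym disjoints1.
Qed.

(** After exchanging the sums, [X] is weighted by the signs of all [B] between [U :\: A] and
    [U :\: X]. This interval sum vanishes unless its two ends agree, that is, unless [X :&: U] is
    [A]. *)
Lemma signed_Q_gdel G U A : A \subset U ->
  \sum_(B : {set T} | (B \subset U) && (U :\: A \subset B))
     (-1) ^+ #|B| * Q (gdel G B) = (-1) ^+ #|U :\: A| * Qtrace G U A.
Proof.
move=> sAU.
under eq_bigr => B _ do rewrite Q_gdelE big_distrr /=.
rewrite (exchange_big_dep (fun X => X \subset verts G)) /=; last first.
  by move=> B X _ /andP[].
rewrite /Qtrace big_distrr /= [RHS]big_mkcondr /=; apply: eq_bigr => X sX.
rewrite -big_distrl /= sX.
have [sub|nsub] := boolP (U :\: A \subset U :\: X).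
  rewrite (eq_bigl (fun B : {set T} => (B \subset U :\: X) && (U :\: A \subset B))).
    rewrite sum_sign_interval //.
    rewrite (_ : (_ :\: _ == _) = (X :&: U == A)).
      by case: eqP => // _; rewrite mul0r.
    apply/eqP/eqP => [e|<-]; last by rewrite setDIr setDv setU0.
    rewrite -[RHS](setIidPl sAU); apply/setP=> z; have /setP/(_ z) := e.
    by rewrite !inE; do 3!case: (z \in _).
  by move=> B; rewrite /= subsetD [in RHS]disjoint_sym andbAC.
(* Here no admissible [B] is disjoint from [X], and [X] cannot have trace [A] either, so both sides
   are zero. *)
rewrite big_pred0 ?mul0r; last first.
  move=> B; apply: contraNF nsub => /andP[/andP[sBU sB] d].
  by apply: subset_trans sB _; rewrite subsetD sBU disjoint_sym.
case: eqP => // e; case/negP: nsub.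
by rewrite -e setDIr setDv setU0.
Qed.

Lemma Q_trace_partition G U :
  Q G = \sum_(A : {set T} | A \subset U) Qtrace G U A.
Proof.
rewrite QE (partition_big (fun X => X :&: U) (fun A => A \subset U)) //= => X _.
exact: subsetIr.
Qed.

(** The exponents of [xf] match by counting union plus intersection, those of [yf] by
    [ncomponents_glue]. *)
Lemma wt_glue H K X1 X2 :
    complete (ginter H K) ->
    X1 \subset verts H -> X2 \subset verts K ->
    X1 :&: verts K = X2 :&: verts H ->
  wt (gunion H K) (X1 :|: X2) =
  (xf ^+ #|X1 :&: X2|)^-1 * (yf ^+ (X1 :&: X2 != set0))^-1
     * (wt H X1 * wt K X2).
Proof.
move=> clq s1 s2 tr; rewrite /wt [X in _ = _ * X]mulrACA -!exprD.
rewrite -ncomponents_glue // -cardsUI !exprD [X in _ = _ * X]mulrACA -invfM.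
by rewrite [RHS]mulrC mulfK // mulf_neq0 // expf_neq0 // ?xf_neq0 ?yf_neq0.
Qed.

(** A set [X] of trace [A] corresponds bijectively to the pair of its restrictions to [H] and [K],
    which are arbitrary sets of trace [A]; the weights then factor by [wt_glue]. *)
Lemma Qtrace_glue H K A :
    let U := verts H :&: verts K in
    complete (ginter H K) -> A \subset U ->
  Qtrace (gunion H K) U A =
  (xf ^+ #|A|)^-1 * (yf ^+ (A != set0))^-1 * (Qtrace H U A * Qtrace K U A).
Proof.
move=> U clq sAU; rewrite /Qtrace big_distrlr /= pair_big /= big_distrr /=.
rewrite (reindex_onto (fun p : {set T} * {set T} => p.1 :|: p.2)
           (fun X => (X :&: verts H, X :&: verts K))) /=; last first.
  by move=> X /andP[sX _]; rewrite -setIUr; apply/setIidPl.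
have key X1 X2 : [&& X1 \subset verts H, X1 :&: U == A,
    X2 \subset verts K & X2 :&: U == A] ->
    [/\ X1 :&: verts K = A, X2 :&: verts H = A & X1 :&: X2 = A].
  case/and4P=> s1 /eqP t1 s2 /eqP t2.
  have e1 : X1 :&: verts K = A by rewrite -t1 setIA (setIidPl s1).
  have e2 : X2 :&: verts H = A by rewrite -t2 setICA setIC (setIidPl s2) setIC.
  split=> //; apply/eqP; rewrite eqEsubset -{1}e1 setIS //= subsetI.
  by rewrite -{1}e1 -e2 !subsetIl.
rewrite (eq_bigl (fun p : {set T} * {set T} =>
    (p.1 \subset verts H) && (p.1 :&: U == A) &&
    ((p.2 \subset verts K) && (p.2 :&: U == A)))).
  apply: eq_bigr => -[X1 X2] /=; rewrite -andbA => h.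
  have [e1 e2 e12] := key _ _ h; case/and4P: h => s1 _ s2 _.
  by rewrite wt_glue ?e1 ?e2 ?e12.
move=> [X1 X2] /=; rewrite xpair_eqE -[RHS]andbA; apply/idP/idP => [|h].
  case/andP=> /andP[_ /eqP <-] /andP[/eqP <- /eqP <-].
  by rewrite !subsetIr /= /U; apply/andP; split; apply/eqP/setP=> z;
    rewrite !inE; do 4!case: (z \in _).
have [e1 e2 e12] := key _ _ h; case/and4P: h => s1 /eqP t1 s2 /eqP t2.
rewrite setUSS //= setIUl t1 t2 setUid eqxx /=.
rewrite !setIUl (setIidPl s1) (setIidPl s2) e1 e2 -e12.
by apply/andP; split; apply/eqP; [apply/setUidPl/subsetIl|apply/setUidPr/subsetIr].
Qed.

End Weights.

Theorem theorem6p2 (T : finType) (G H K Kr : sgraph T)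
    (G_connected : gconnected G)
    (H_sub : subgraph H G) (K_sub : subgraph K G)
    (HUK : gunion H K = G) (HIK : ginter H K = Kr)
    (Kr_complete : complete Kr)
    (H_neq : H <> Kr) (K_neq : K <> Kr) :
  let U := verts Kr in
  Q G = Q (gdel H U) * Q (gdel K U)
    + yf^-1 *
      \sum_(A : {set T} | (A != set0) && (A \subset U))
        (xf ^+ #|A|)^-1 *
        \sum_(B : {set T} | (B \subset U) && (U :\: A \subset B))
          \sum_(C : {set T} | (C \subset U) && (U :\: A \subset C))
            (-1) ^+ (#|B| + #|C|) * Q (gdel H B) * Q (gdel K C).
Proof.
have UE : verts Kr = verts H :&: verts K by rewrite -HIK.
rewrite UE -HUK; set W := verts H :&: verts K => {UE}.
have clq : complete (ginter H K) by rewrite HIK.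
(* The empty trace needs no division and yields the product [Q(H-U) Q(K-U)]; every other trace
   carries one factor [yf^-1]. *)
rewrite (Q_trace_partition _ W) (bigD1 set0) ?sub0set //=.
rewrite Qtrace_glue ?sub0set // cards0 eqxx !expr0 !invr1 !mul1r !Q_gdel_trace.
congr (_ + _); rewrite big_distrr /=.
apply: eq_big => [A|A /andP[sA nA]]; first by rewrite andbC.
rewrite Qtrace_glue // nA expr1 [_^-1 * yf^-1]mulrC -mulrA; congr (_ * (_ * _)).
under eq_bigr => B _.
  under eq_bigr => C _ do rewrite exprD -mulrA mulrACA.
  over.
(* Both sides contribute the same sign, a power of [-1] with exponent [#|W :\: A|], whose square is
   one. *)
rewrite -big_distrlr /= !signed_Q_gdel // mulrACA -exprD addnn -mul2n exprM.
by rewrite sqrrN expr1n expr1n mul1r.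
Qed.
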